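(* Let $\mathcal Q$ be an almost structurally complete semisimple quasivariety and let $\mathbf F$ be the free algebra for $\mathcal Q$ of denumerable rank. Then $\mathcal Q$ is structurally complete if and only if there exists an elementary extension of $\mathbf F$ with an idempotent element or $\mathcal Q$ is a minimal quasivariety.
   Context: A quasivariety is a class of algebras defined by quasi-identities $(\forall\bar x)[\varphi(\bar x)\to\psi(\bar x)]$ with $\varphi$ a finite (possibly empty) conjunction of equations and $\psi$ an equation. $\mathbf F$ is the free algebra for $\mathcal Q$ over a countably infinite set of variables. A quasi-identity is $\mathcal Q$-admissible if it holds in $\mathbf F$; an admissible quasi-identity $(\forall\bar x)[\varphi\to\psi]$ is $\mathcal Q$-passive if $\mathbf F\models(\forall\bar x)\neg\varphi(\bar x)$ and $\mathcal Q$-active otherwise. $\mathcal Q$ is structurally complete if every admissible quasi-identity holds in $\mathcal Q$, and almost structurally complete if every active quasi-identity holds in $\mathcal Q$. An element $e$ is idempotent if $f(e,\dots,e)=e$ for every basic operation $f$. A congruence $\alpha$ of $\mathbf A$ is a $\mathcal Q$-congruence if $\mathbf A/\alpha\in\mathcal Q$; the $\mathcal Q$-congruences form a lattice $\mathrm{Con}_{\mathcal Q}(\mathbf A)$. A nontrivial algebra $\mathbf A\in\mathcal Q$ is $\mathcal Q$-subdirectly irreducible if the identity relation is completely meet irreducible in $\mathrm{Con}_{\mathcal Q}(\mathbf A)$, and $\mathcal Q$-simple if $\mathrm{Con}_{\mathcal Q}(\mathbf A)$ has exactly two elements. $\mathcal Q$ is semisimple if every $\mathcal Q$-subdirectly irreducible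 algebra is $\mathcal Q$-simple. $\mathcal Q$ is minimal if its only proper subquasivariety is the trivial quasivariety (consisting of one-element algebras). *)

(* Defs.v *)
From mathcomp Require Import all_boot generic_quotient.
From mathcomp Require Import boolp.

Set Implicit Arguments.
Unset Strict Implicit.
Unset Printing Implicit Defensive.

Local Open Scope quotient_scope.

(** * Algebras, terms, quasi-identities *)

Record signature := Signature { op : Type; arity : op -> nat }.

(* Operations of arity 0 are allowed; carriers are nonempty. *)
Record algebra (S : signature) := Algebra {
  carrier :> Type;
  interp : forall f : op S, ('I_(arity f) -> carrier) -> carrier;
  carrier_inhabited : inhabited carrier }.

Arguments interp {S} a f _.

Inductive term (S : signature) : Type :=
| Var of nat
| App (f : op S) of 'I_(arity f) -> term S.

Arguments Var {S} _.
Arguments App {S} f _.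

Fixpoint eval (S : signature) (A : algebra S) (v : nat -> A) (t : term S) : A :=
  match t with
  | Var n => v n
  | App f ts => interp A f (fun i => eval v (ts i))
  end.

Record equation (S : signature) := Equation { lhs : term S; rhs : term S }.

Definition eq_sat (S : signature) (A : algebra S) (v : nat -> A)
  (e : equation S) : Prop := eval v (lhs e) = eval v (rhs e).

Record quasi_identity (S : signature) := QuasiIdentity {
  premises : seq (equation S);
  conclusion : equation S }.

Fixpoint conj_sat (S : signature) (A : algebra S) (v : nat -> A)
    (p : seq (equation S)) : Prop :=
  match p with
  | [::] => True
  | e :: p' => eq_sat v e /\ conj_sat v p'
  end.

Definition holds (S : signature) (A : algebra S) (q : quasi_identity S) : Prop :=
  forall v : nat -> A, conj_sat v (premises q) -> eq_sat v (conclusion q).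

Definition holds_in (S : signature) (K : algebra S -> Prop)
  (q : quasi_identity S) : Prop := forall A, K A -> holds A q.

Definition is_quasivariety (S : signature) (K : algebra S -> Prop) : Prop :=
  exists T : quasi_identity S -> Prop,
    forall A, K A <-> (forall q, T q -> holds A q).

Definition trivial_algebra (S : signature) (A : algebra S) : Prop :=
  forall x y : A, x = y.

Definition is_hom (S : signature) (A B : algebra S) (h : A -> B) : Prop :=
  forall (f : op S) (a : 'I_(arity f) -> A),
    h (interp A f a) = interp B f (fun i => h (a i)).

Definition idempotent_element (S : signature) (A : algebra S) (e : A) : Prop :=
  forall f : op S, interp A f (fun _ => e) = e.

(** * Congruences and quotients *)

Record congruence (S : signature) (A : algebra S) := Congruence {
  cong_rel :> A -> A -> Prop;
  cong_refl : forall x, cong_rel x x;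
  cong_sym : forall x y, cong_rel x y -> cong_rel y x;
  cong_trans : forall x y z, cong_rel x y -> cong_rel y z -> cong_rel x z;
  cong_compat : forall (f : op S) (a b : 'I_(arity f) -> A),
    (forall i, cong_rel (a i) (b i)) -> cong_rel (interp A f a) (interp A f b) }.

Section Quotient.
Variables (S : signature) (A : algebra S) (alpha : congruence A).

Definition cong_bool : rel {classic A} := fun x y => `[< alpha x y >].

Lemma cong_bool_refl : reflexive cong_bool.
Proof. by move=> x; apply/asboolP; apply: cong_refl. Qed.

Lemma cong_bool_sym : symmetric cong_bool.
Proof. by move=> x y; apply/asboolP/asboolP; apply: cong_sym. Qed.

Lemma cong_bool_trans : transitive cong_bool.
Proof.
move=> y x z /asboolP xy /asboolP yz; apply/asboolP.
exact: cong_trans xy yz.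
Qed.

Definition cong_equiv : equiv_rel {classic A} :=
  EquivRel cong_bool cong_bool_refl cong_bool_sym cong_bool_trans.

Definition quot_carrier : Type := {eq_quot cong_equiv}.

Definition quot_pi (x : A) : quot_carrier :=
  \pi_{eq_quot cong_equiv} (x : {classic A}).

Definition quot_repr (u : quot_carrier) : A := repr (u : {eq_quot cong_equiv}).

(* Operations act on chosen representatives; [quot_pi_hom] below shows that
   the choice is immaterial. *)
Definition quot_interp (f : op S) (a : 'I_(arity f) -> quot_carrier) :
  quot_carrier := quot_pi (interp A f (fun i => quot_repr (a i))).

Lemma quot_inhabited : inhabited quot_carrier.
Proof. by case: (carrier_inhabited A) => x; exists; apply: (quot_pi x). Qed.

Definition quot_alg : algebra S := Algebra quot_interp quot_inhabited.

Lemma quot_piP (x y : A) : quot_pi x = quot_pi y <-> alpha x y.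
Proof.
split=> [/eqmodP /asboolP // | xy].
by apply/eqmodP/asboolP.
Qed.

Lemma quot_reprK (u : quot_carrier) : quot_pi (quot_repr u) = u.
Proof. exact: reprK. Qed.

Lemma quot_pi_hom : is_hom (B := quot_alg) quot_pi.
Proof.
move=> f a; apply/quot_piP; apply: cong_compat => i.
by apply/quot_piP; rewrite quot_reprK.
Qed.

End Quotient.

Definition cong_le (S : signature) (A : algebra S) (a b : congruence A) : Prop :=
  forall x y, a x y -> b x y.

Definition cong_eq (S : signature) (A : algebra S) (a b : congruence A) : Prop :=
  forall x y, a x y <-> b x y.

Definition id_cong (S : signature) (A : algebra S) : congruence A.
Proof.
refine (@Congruence S A (fun x y => x = y) _ _ _ _).
- by [].
- by [].
- by move=> x y z -> ->.
- by move=> f a b ab; congr (interp A f _); apply: funext.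
Defined.

(** * Relative congruences *)

Section Relative.
Variables (S : signature) (K : algebra S -> Prop).

(* Membership in the lattice Con_K(A), ordered by [cong_le]. *)
Definition ConK (A : algebra S) (a : congruence A) : Prop := K (quot_alg a).

Definition is_meet (A : algebra S) (X : congruence A -> Prop)
    (m : congruence A) : Prop :=
  [/\ ConK m,
      forall a, X a -> cong_le m a
    & forall b, ConK b -> (forall a, X a -> cong_le b a) -> cong_le b m].

Definition completely_meet_irreducible (A : algebra S) (m : congruence A) : Prop :=
  ConK m /\
  forall X : congruence A -> Prop, (forall a, X a -> ConK a) ->
    is_meet X m -> exists2 a, X a & cong_eq a m.

Definition subdirectly_irreducible (A : algebra S) : Prop :=
  [/\ K A, ~ trivial_algebra A & completely_meet_irreducible (id_cong A)].

Definition simple (A : algebra S) : Prop :=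
  [/\ K A, ~ trivial_algebra A &
      exists a b : congruence A,
        [/\ ConK a, ConK b, ~ cong_eq a b
          & forall c, ConK c -> cong_eq c a \/ cong_eq c b]].

Definition semisimple : Prop :=
  forall A, subdirectly_irreducible A -> simple A.

End Relative.

(** * The free algebra of denumerable rank *)

Definition term_alg (S : signature) : algebra S :=
  Algebra (@App S) (inhabits (Var 0)).

Section Free.
Variables (S : signature) (K : algebra S -> Prop).

Definition identities_cong : congruence (term_alg S).
Proof.
refine (@Congruence S (term_alg S) (fun t s : term S =>
  forall A, K A -> forall v : nat -> A, eval v t = eval v s) _ _ _ _).
- by [].
- by move=> t s ts A KA v; rewrite ts.
- by move=> t s u ts su A KA v; rewrite ts // su.
- move=> f a b ab A KA v /=; congr (interp A f _).
  by apply: funext => i; apply: ab.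
Defined.

Definition free_alg : algebra S := quot_alg identities_cong.

Definition free_var (n : nat) : free_alg := quot_pi identities_cong (Var n).

Lemma eval_free (s : nat -> term S) (t : term S) :
  eval (A := free_alg) (fun n => quot_pi identities_cong (s n)) t =
  quot_pi identities_cong (eval (A := term_alg S) s t).
Proof.
elim: t => [n //|f a IH] /=.
rewrite (quot_pi_hom identities_cong (f := f)) /=.
by congr (quot_interp _); apply: funext => i; apply: IH.
Qed.

Lemma eval_subst (A : algebra S) (v : nat -> A) (s : nat -> term S) (t : term S) :
  eval v (eval (A := term_alg S) s t) = eval (fun n => eval v (s n)) t.
Proof.
elim: t => [n //|f a IH] /=.
by congr (interp A f _); apply: funext => i; apply: IH.
Qed.

Lemma free_alg_mem : is_quasivariety K -> K free_alg.
Proof.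
case=> T KT; apply/KT => q Tq w.
pose s n := quot_repr (w n) : term S.
have -> : w = fun n => quot_pi identities_cong (s n).
  by apply: funext => n; rewrite /s quot_reprK.
have satE e : eq_sat (A := free_alg) (fun n => quot_pi identities_cong (s n)) e <->
    forall A, K A -> forall v : nat -> A, eq_sat (fun n => eval v (s n)) e.
  rewrite /eq_sat !eval_free quot_piP /=.
  by split=> h A KA v; move: (h A KA v); rewrite !eval_subst.
move=> prem; apply/satE => A KA v.
apply: (proj1 (KT A) KA q Tq).
elim: (premises q) prem => //= e p IH [/satE he /IH hp]; split=> //.
exact: he.
Qed.

Lemma free_alg_universal (A : algebra S) (v : nat -> A) : K A ->
  exists! h : free_alg -> A, is_hom h /\ forall n, h (free_var n) = v n.
Proof.
move=> KA; pose h (u : free_alg) := eval v (quot_repr u : term S).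
have hpi t : h (quot_pi identities_cong t) = eval v t.
  have /quot_piP := quot_reprK (quot_pi identities_cong t).
  exact.
exists h; split.
  split=> [f a|n]; last exact: (hpi (Var n)).
  by rewrite /= /quot_interp hpi.
move=> g [ghom gv]; apply: funext => u; rewrite /h -[in RHS](quot_reprK u).
elim: (quot_repr u : term S) => [n|f a IH] /=; first by rewrite -gv.
rewrite (quot_pi_hom identities_cong (f := f)) ghom.
by congr (interp A f _); apply: funext => i; apply: IH.
Qed.

(** * Structural completeness *)

Definition admissible (q : quasi_identity S) : Prop := holds free_alg q.

Definition passive (q : quasi_identity S) : Prop :=
  admissible q /\ forall v : nat -> free_alg, ~ conj_sat v (premises q).

Definition active (q : quasi_identity S) : Prop := admissible q /\ ~ passive q.

Definition structurally_complete : Prop :=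
  forall q, admissible q -> holds_in K q.

Definition almost_structurally_complete : Prop :=
  forall q, active q -> holds_in K q.

End Free.

(* R is a proper subquasivariety of K. *)
Definition proper_subquasivariety (S : signature) (R K : algebra S -> Prop) : Prop :=
  [/\ is_quasivariety R, forall A, R A -> K A & exists2 A, K A & ~ R A].

(* The proper subquasivarieties of K are exactly the trivial quasivariety, so
   that the trivial quasivariety itself is not minimal. *)
Definition minimal_quasivariety (S : signature) (K : algebra S -> Prop) : Prop :=
  forall R : algebra S -> Prop,
    proper_subquasivariety R K <-> (forall A, R A <-> trivial_algebra A).

(** * First-order logic *)

(* The remaining connectives are definable from these classically. *)
Inductive formula (S : signature) : Type :=
| FEq of term S & term S
| FFalse
| FImp of formula S & formula S
| FAll of nat & formula S.

Fixpoint fsat (S : signature) (A : algebra S) (v : nat -> A) (p : formula S) : Prop :=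
  match p with
  | FEq t s => eval v t = eval v s
  | FFalse => False
  | FImp p1 p2 => fsat v p1 -> fsat v p2
  | FAll n p1 => forall a : A, fsat (fun m => if m == n then a else v m) p1
  end.

(* B is an elementary extension of A up to identifying A with its image. *)
Definition elementary_extension (S : signature) (A B : algebra S) : Prop :=
  exists i : A -> B, forall (p : formula S) (v : nat -> A),
    fsat v p <-> fsat (fun n => i (v n)) p.

(* Main.v *)
(** If an elementary extension of [free_alg Q] has an idempotent [e], then no
    finite set of equations is unsolvable in [free_alg Q]: all variables may be
    sent to [e].  So every admissible quasi-identity is active.  If [Q] is
    minimal, it is generated by [free_alg Q].

    Conversely, suppose that no such extension exists.  By compactness
    (an ultrapower) there are finitely many operations without a common
    idempotent in [free_alg Q], and structural completeness transfers this to
    all nontrivial members of [Q].  Let [A] be a nontrivial member of [Q] that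
    satisfies [phi -> psi]; we claim that [Q] satisfies [phi -> psi].  If not,
    it fails in some quotient of the term algebra by a congruence maximal
    among those that contain [phi] and omit [psi].  This quotient is
    subdirectly irreducible, hence simple, so adding [psi] to its diagram
    collapses it; finitely many equations [Delta] of the diagram suffice to
    derive together with [psi] the idempotency of a variable under the above
    operations.  As [phi] and [Delta] are jointly satisfied in the quotient
    without [psi], structural completeness gives a solution of [phi] and
    [Delta] in [free_alg Q], and so in [A].  There [psi] holds too, so [A] is
    trivial, a contradiction. *)

From HB Require Import structures.
From mathcomp Require Import all_boot.
From mathcomp Require Import boolp classical_sets filter.
Require Import Defs.

Set Implicit Arguments.
Unset Strict Implicit.
Unset Printing Implicit Defensive.

Local Open Scope classical_set_scope.

HB.instance Definition _ (S : signature) := gen_eqMixin (equation S).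

(** * Homomorphisms, substitutions and congruences *)

Section Basics.
Variable S : signature.

Definition subst_eqn (s : nat -> term S) (e : equation S) : equation S :=
  Equation (eval (A := term_alg S) s (lhs e)) (eval (A := term_alg S) s (rhs e)).

Lemma eq_sat_subst (A : algebra S) (v : nat -> A) s e :
  eq_sat v (subst_eqn s e) <-> eq_sat (fun n => eval v (s n)) e.
Proof. by rewrite /eq_sat /= !eval_subst. Qed.

Lemma conj_satP (A : algebra S) (v : nat -> A) p :
  conj_sat v p <-> forall e, e \in p -> eq_sat v e.
Proof.
elim: p => [|d p IH] /=; first by split.
split=> [[vd /IH vp] e|vp].
  by rewrite inE => /orP[/eqP->|/vp].
split; first by apply: vp; rewrite mem_head.
by apply/IH => e ep; apply: vp; rewrite inE ep orbT.
Qed.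

Lemma eval_hom (A B : algebra S) (h : A -> B) (v : nat -> A) t :
  is_hom h -> eval (fun n => h (v n)) t = h (eval v t).
Proof.
move=> hh; elim: t => [n //|f a IH] /=.
by rewrite hh; congr (interp B f _); apply: funext => i; apply: IH.
Qed.

Lemma eq_sat_hom (A B : algebra S) (h : A -> B) (v : nat -> A) e :
  is_hom h -> eq_sat v e -> eq_sat (fun n => h (v n)) e.
Proof. by move=> hh; rewrite /eq_sat !eval_hom // => ->. Qed.

Lemma eval_Var t : eval (A := term_alg S) Var t = t.
Proof. by elim: t => [n //|f a IH] /=; congr (App _); apply: funext. Qed.

Lemma eval_idempotent (A : algebra S) (e : A) t :
  idempotent_element e -> eval (fun=> e) t = e.
Proof.
move=> he; elim: t => [n //|f a IH] /=.
by rewrite -[RHS](he f); congr (interp A f _); apply: funext.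
Qed.

Lemma eq_sat_quot (A : algebra S) (a : congruence A) (v : nat -> A) e :
  eq_sat (A := quot_alg a) (fun n => quot_pi a (v n)) e <->
  a (eval v (lhs e)) (eval v (rhs e)).
Proof.
by rewrite /eq_sat !(eval_hom (B := quot_alg a) _ _ (quot_pi_hom a)) quot_piP.
Qed.

Lemma eq_sat_term_quot (a : congruence (term_alg S)) e :
  eq_sat (A := quot_alg a) (fun n => quot_pi a (Var n)) e <-> a (lhs e) (rhs e).
Proof. by rewrite (eq_sat_quot a Var) !eval_Var. Qed.

Definition preim_cong (A B : algebra S) (h : A -> B) (hh : is_hom h)
  (b : congruence B) : congruence A.
Proof.
refine (@Congruence S A (fun x y => b (h x) (h y)) _ _ _ _).
- by move=> x; apply: cong_refl.
- by move=> x y; apply: cong_sym.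
- by move=> x y z; apply: cong_trans.
- by move=> f u v uv; rewrite !hh; apply: cong_compat.
Defined.

Lemma quot_repr_pi (A : algebra S) (a : congruence A) x :
  a (quot_repr (quot_pi a x)) x.
Proof. by apply/quot_piP; rewrite quot_reprK. Qed.

(** The congruence [b/a] of the correspondence theorem; [quot_congE] shows that the choice of
    representatives is immaterial. *)
Definition quot_cong (A : algebra S) (a b : congruence A) (ab : cong_le a b) :
  congruence (quot_alg a).
Proof.
refine (@Congruence S (quot_alg a)
  (fun x y => b (quot_repr x) (quot_repr y)) _ _ _ _).
- by move=> x; apply: cong_refl.
- by move=> x y; apply: cong_sym.
- by move=> x y z; apply: cong_trans.
- move=> f u v uv.
  apply: cong_trans (ab _ _ (quot_repr_pi a _)) _; apply: cong_sym.
  apply: cong_trans (ab _ _ (quot_repr_pi a _)) _; apply: cong_sym.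
  exact: cong_compat.
Defined.

Lemma quot_congE (A : algebra S) (a b : congruence A) (ab : cong_le a b) x y :
  quot_cong ab (quot_pi a x) (quot_pi a y) <-> b x y.
Proof.
have xb z := ab _ _ (quot_repr_pi a z).
split=> /= h; last exact: cong_trans (xb x) (cong_trans h (cong_sym (xb y))).
exact: cong_trans (cong_sym (xb x)) (cong_trans h (xb y)).
Qed.

Definition total_cong (A : algebra S) : congruence A.
Proof. by refine (@Congruence S A (fun _ _ => True) _ _ _ _). Defined.

End Basics.

(** * Members of a quasivariety and relative congruences *)

Section Quasivariety.
Variables (S : signature) (K : algebra S -> Prop).
Hypothesis hK : is_quasivariety K.

(** Every axiom holds in [K], so the unnamed axiom set may be exchanged for all quasi-identities
    valid in [K]. *)
Lemma quasivarietyP (A : algebra S) :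
  K A <-> forall q, holds_in K q -> holds A q.
Proof.
split=> [KA q|hA]; first exact.
have [T KT] := hK; apply/KT => q Tq; apply: hA => B /KT; exact.
Qed.

Lemma trivial_mem (A : algebra S) : trivial_algebra A -> K A.
Proof. by move=> trivA; apply/quasivarietyP => q _ v _; apply: trivA. Qed.

Lemma ConKP (A : algebra S) (a : congruence A) : ConK K a <->
  forall q, holds_in K q -> forall v : nat -> A,
    (forall e, e \in premises q -> a (eval v (lhs e)) (eval v (rhs e))) ->
    a (eval v (lhs (conclusion q))) (eval v (rhs (conclusion q))).
Proof.
rewrite /ConK quasivarietyP; split=> [aK q Kq v vp|aK q Kq w].
  apply/eq_sat_quot/aK => //.
  by apply/conj_satP => e ep; apply/eq_sat_quot/vp.
have -> : w = fun n => quot_pi a (quot_repr (w n)).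
  by apply: funext => n; rewrite quot_reprK.
by move=> /conj_satP vp; apply/eq_sat_quot/aK => // e /vp /eq_sat_quot.
Qed.

Lemma ConK_preim (A B : algebra S) (h : A -> B) (hh : is_hom h)
    (b : congruence B) : ConK K b -> ConK K (preim_cong hh b).
Proof.
move=> /ConKP bK; apply/ConKP => q Kq v vp /=.
rewrite -!(eval_hom _ _ hh); apply: bK => // e ep.
by rewrite !(eval_hom _ _ hh); apply: vp.
Qed.

Lemma ConK_quot_cong (A : algebra S) (a b : congruence A) (ab : cong_le a b) :
  ConK K b -> ConK K (quot_cong ab).
Proof.
move=> /ConKP bK; apply/ConKP => q Kq w.
have -> : w = fun n => quot_pi a (quot_repr (w n)).
  by apply: funext => n; rewrite quot_reprK.
have evE t := eval_hom (B := quot_alg a) (fun n => quot_repr (w n)) t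
  (quot_pi_hom a).
by rewrite !evE => wp; apply/quot_congE/bK => // e /wp; rewrite !evE quot_congE.
Qed.

Lemma ConK_id (A : algebra S) : K A -> ConK K (id_cong A).
Proof.
by move=> KA; apply/ConKP => q Kq v vp; apply: (Kq A KA); apply/conj_satP.
Qed.

Lemma ConK_total (A : algebra S) : ConK K (total_cong A).
Proof. by apply/ConKP. Qed.

(** The identity and the total congruence differ, so they are the only two relative congruences, and
    [c] is not the identity. *)
Lemma simple_total (A : algebra S) (c : congruence A) x y :
  simple K A -> ConK K c -> c x y -> x <> y -> forall z w, c z w.
Proof.
case=> KA ntA [a [b [Ka Kb nab ab]]] Kc cxy xy.
have := ab _ (ConK_total A); have := ab _ (ConK_id KA); have := ab _ Kc.
have nid d : cong_eq c d -> cong_eq (id_cong A) d -> False.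
  by move=> cd id; apply: xy; apply/id/cd.
have total d : cong_eq c d -> cong_eq (total_cong A) d -> forall z w, c z w.
  by move=> cd td z w; apply/cd/td.
have ntriv d : cong_eq (id_cong A) d -> cong_eq (total_cong A) d -> False.
  by move=> id td; apply: ntA => z w; apply/id/td.
move=> [ca|cb] [ia|ib] [ta|tb].
- by case: (nid a).
- by case: (nid a).
- exact: total ta.
- by case: (ntriv b).
- by case: (ntriv a).
- exact: total tb.
- by case: (nid b).
- by case: (nid b).
Qed.

(** * Equational consequence *)

(** Finiteness of the premises is built in, so that unions of chains need no compactness theorem. *)
Definition conseq (X : set (equation S)) (e : equation S) : Prop :=
  exists D : seq (equation S),
    (forall d, d \in D -> X d) /\ holds_in K (QuasiIdentity D e).

Lemma conseq_mem (X : set (equation S)) e : X e -> conseq X e.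
Proof.
move=> Xe; exists [:: e]; split=> [d|A KA v /=]; last by case.
by rewrite inE => /eqP->.
Qed.

Lemma conseq_finite (I : eqType) (l : seq I) (X : set (equation S))
    (e : I -> equation S) : (forall i, i \in l -> conseq X (e i)) ->
  exists D : seq (equation S), (forall d, d \in D -> X d) /\
    forall A, K A -> forall v : nat -> A, conj_sat v D ->
    forall i, i \in l -> eq_sat v (e i).
Proof.
elim: l => [|j l IH] lX; first by exists [::].
have [i il|D [DX De]] := IH; first by apply: lX; rewrite inE il orbT.
have [E [EX Ee]] := lX j (mem_head _ _).
exists (E ++ D); split=> [d|A KA v /conj_satP vED i].
  by rewrite mem_cat => /orP[/EX|/DX].
rewrite inE => /orP[/eqP->|il].
  by apply: (Ee A KA); apply/conj_satP => d dE; apply: vED; rewrite mem_cat dE.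
apply: (De A KA) il; apply/conj_satP => d dD.
by apply: vED; rewrite mem_cat dD orbT.
Qed.

Lemma conseq_cut (I : eqType) (l : seq I) (X : set (equation S))
    (e : I -> equation S) c : (forall i, i \in l -> conseq X (e i)) ->
  (forall A, K A -> forall v : nat -> A,
    (forall i, i \in l -> eq_sat v (e i)) -> eq_sat v c) ->
  conseq X c.
Proof.
move=> /conseq_finite[D [DX De]] lc; exists D; split=> // A KA v vD.
by apply: lc => // i il; apply: De il.
Qed.

(** The relative congruence generated by [X], by [ConK_conseq] and [conseq_cong_min]. *)
Definition conseq_cong (X : set (equation S)) : congruence (term_alg S).
Proof.
refine (@Congruence S (term_alg S) (fun t s => conseq X (Equation t s)) _ _ _ _).
- by move=> t; exists [::].
- by move=> t s [D [DX De]]; exists D; split=> // A KA v /(De A KA v) /esym.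
- move=> t s u ts su.
  apply: (@conseq_cut _ [:: Equation t s; Equation s u] X id) => [i|A KA v h].
    by rewrite !inE => /orP[] /eqP->.
  rewrite /eq_sat /=; have /= := h (Equation t s); rewrite /eq_sat /= => ->.
    by apply: (h (Equation s u)); rewrite !inE eqxx orbT.
  by rewrite inE eqxx.
- move=> f a b ab.
  apply: (@conseq_cut _ (enum 'I_(arity f)) X (fun i => Equation (a i) (b i))).
    by move=> i _; apply: ab.
  move=> A KA v h; rewrite /eq_sat /=; congr (interp A f _).
  by apply: funext => i; apply: h; rewrite mem_enum.
Defined.

Lemma ConK_conseq (X : set (equation S)) : ConK K (conseq_cong X).
Proof.
apply/ConKP => q Kq s sp.
apply: (@conseq_cut _ (premises q) X (subst_eqn s)) => // A KA v h.
by apply/(eq_sat_subst _ s)/(Kq A KA)/conj_satP => e /h /eq_sat_subst.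
Qed.

Lemma conseq_cong_min (X : set (equation S)) (g : congruence (term_alg S)) :
  ConK K g -> (forall e, X e -> g (lhs e) (rhs e)) ->
  cong_le (conseq_cong X) g.
Proof.
move=> gK Xg t s [D [DX De]].
apply/(eq_sat_term_quot g (Equation t s))/(De _ gK)/conj_satP => d /DX /Xg gd.
exact/eq_sat_term_quot.
Qed.

Definition diagram (a : congruence (term_alg S)) : set (equation S) :=
  [set e | a (lhs e) (rhs e)].

Lemma diagram_conseq (X : set (equation S)) :
  diagram (conseq_cong X) = conseq X.
Proof. by apply: funext => -[]. Qed.

(** * Maximal relative congruences omitting an equation *)

(** Zorn's lemma applies because finitely many premises drawn from the union of a chain already come
    from one member. *)
Lemma maximal_omitting (X : set (equation S)) e : ~ conseq X e ->
  exists a : congruence (term_alg S),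
    [/\ ConK K a, X `<=` diagram a, ~ diagram a e
      & forall g, ConK K g -> cong_le a g -> ~ diagram g e -> cong_le g a].
Proof.
(* [X] is kept apart from [Y] so that [P] also holds of the empty chain's
   union. *)
move=> Xe; pose P Y := ~ conseq (Y `|` X) e.
have [F FP Ftot|Y [PY Ymax]] := @Zorn_bigcup (equation S) P.
  move=> [D [DFX De]].
  have [DX|[Y FY DYX]] : (forall d, d \in D -> X d) \/
      exists2 Y, F Y & forall d, d \in D -> (Y `|` X) d.
  - elim: D {De} DFX => [|d D IH] DFX; first by left.
    have [i iD|DX|[Y FY DYX]] := IH.
    + by apply: DFX; rewrite inE iD orbT.
    + case: (DFX d (mem_head _ _)) => [[Y FY Yd]|Xd].
        right; exists Y => // i; rewrite inE => /orP[/eqP->|/DX]; first by left.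
        by right.
      by left=> i; rewrite inE => /orP[/eqP->|/DX].
    + right; case: (DFX d (mem_head _ _)) => [[Z FZ Zd]|Xd].
        have [YZ|ZY] := Ftot Y Z FY FZ.
          exists Z => // i; rewrite inE => /orP[/eqP->|/DYX]; first by left.
          by case=> [/YZ|]; [left|right].
        exists Y => // i; rewrite inE => /orP[/eqP->|/DYX //].
        by left; apply: ZY.
      exists Y => // i; rewrite inE => /orP[/eqP->|/DYX //].
      by right.
  - by apply: Xe; exists D.
  - by apply: (FP Y FY); exists D.
exists (conseq_cong (Y `|` X)); split.
- exact: ConK_conseq.
- by rewrite diagram_conseq => d Xd; apply: conseq_mem; right.
- by rewrite diagram_conseq.
- move=> g gK ag ge t s gts.
  have YXg : Y `|` X `<=` diagram g.
    by move=> [u w] YXu; apply: ag; apply: conseq_mem.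
  (* [diagram g] properly extends [Y], yet all its consequences lie in [g], which omits [e]. *)
  apply: contrapT => nts; apply: (Ymax (diagram g)).
    split; first by move=> d Yd; apply: YXg; left.
    by move=> /(_ (Equation t s) gts) Yts; apply: nts; apply: conseq_mem; left.
  rewrite /P -diagram_conseq => he; apply: ge.
  apply: (conseq_cong_min (X := diagram g `|` X) gK) he => d [//|Xd].
  by apply: YXg; right.
Qed.

(** A nonidentity relative congruence of the quotient pulls back to one strictly above [a], which
    contains [e] by maximality. So the congruence generated by [a] and [e] induces a monolith. *)
Lemma maximal_omitting_subdirectly_irreducible
    (a : congruence (term_alg S)) e : ConK K a -> ~ diagram a e ->
  (forall g, ConK K g -> cong_le a g -> ~ diagram g e -> cong_le g a) ->
  subdirectly_irreducible K (quot_alg a).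
Proof.
move=> aK ae amax; split=> //.
  by move=> triv; apply/ae/quot_piP/triv.
split=> [|X XK [_ _ Xmin]]; first exact: ConK_id.
pose b := conseq_cong (diagram a `|` [set e]).
have ab : cong_le a b by move=> t s ats; apply: conseq_mem; left.
have be : diagram b e.
  by rewrite diagram_conseq; apply: conseq_mem; right.
have bK : ConK K (quot_cong ab) by apply/ConK_quot_cong/ConK_conseq.
apply: contrapT => nX; apply: ae.
suff b_id : cong_le (quot_cong ab) (id_cong (quot_alg a)).
  by apply/(quot_piP a)/b_id/quot_congE.
apply: Xmin => // c Xc.
pose g := preim_cong (quot_pi_hom a) c.
have gK : ConK K g by apply/ConK_preim/XK.
have ag : cong_le a g.
  by move=> t s /quot_piP /= ->; apply: cong_refl.
have ge : diagram g e.
  apply: contrapT => /(amax _ gK ag) ga; apply: nX; exists c => // x y.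
  split=> [cxy|->]; last exact: cong_refl.
  rewrite -(quot_reprK x) -(quot_reprK y); apply/quot_piP/ga.
  by rewrite /= !quot_reprK.
have bg : cong_le b g.
  by apply: conseq_cong_min => // d [/ag //|->].
by move=> x y /bg /=; rewrite !quot_reprK.
Qed.

End Quasivariety.

(** * Ultrapowers *)

Section Ultrapower.
Variables (S : signature) (A : algebra S) (I : Type) (U : set_system I).
Context {UU : UltraFilter U}.

Definition power_alg : algebra S :=
  @Algebra S (I -> A) (fun f a i => interp A f (fun j => a j i))
    (let: inhabits x := carrier_inhabited A in inhabits (fun=> x)).

Lemma eval_power (v : nat -> power_alg) t i :
  eval v t i = eval (fun n => v n i) t.
Proof.
elim: t => [n //|f a IH] /=.
by congr (interp A f _); apply: funext => j; apply: IH.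
Qed.

Definition ultra_cong : congruence power_alg.
Proof.
refine (@Congruence S power_alg (fun g h => U [set i | g i = h i]) _ _ _ _).
- by move=> g; apply: filterE.
- by move=> g h; apply: filterS => i /esym.
- by move=> g h k; apply: filterS2 => i /= -> ->.
- move=> f a b ab /=.
  apply: filterS (filter_forall (F := U) _ ab) => i abi /=.
  by congr (interp A f _); apply: funext => j; apply: abi.
Defined.

Definition ultrapower : algebra S := quot_alg ultra_cong.

Definition ultra_class (g : I -> A) : ultrapower := quot_pi ultra_cong g.

Lemma ultra_not (P : set I) : U (~` P) <-> ~ U P.
Proof.
split=> [UP UP'|]; last by case: (in_ultra_setVsetC P UU).
by apply: (@filter_not_empty _ U _); rewrite -(setICr P); apply: filterI.
Qed.

Theorem Los (p : formula S) (g : nat -> I -> A) :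
  fsat (fun n => ultra_class (g n)) p <-> U [set i | fsat (fun n => g n i) p].
Proof.
elim: p g => [t s|| p IHp q IHq|n p IH] g /=.
- rewrite !(eval_hom (B := ultrapower) _ _ (quot_pi_hom ultra_cong)) quot_piP /=.
  by split; apply: filterS => i /=; rewrite !eval_power.
- by split=> // U0; apply: (@filter_not_empty _ U _); apply: filterS U0.
- rewrite IHp IHq; split=> [pq|Upq Up].
    2: by apply: filterS2 Upq Up => i /= pq; apply: pq.
  have [/pq|/ultra_not] := EM (U [set i | fsat (fun n => g n i) p]).
    by apply: filterS => i /= qi _.
  by apply: filterS => i /= np /np.
have updE (h : I -> A) (v : nat -> I -> A) :
    (fun m => if m == n then ultra_class h else ultra_class (v m)) =
    (fun m => ultra_class (if m == n then h else v m)).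
  by apply: funext => m; case: eqP.
have updEi (h : I -> A) (v : nat -> I -> A) i :
    (fun m => if m == n then h i else v m i) =
    (fun m => (if m == n then h else v m) i).
  by apply: funext => m; case: eqP.
split=> [pg|Up a].
  (* [h i] is a counterexample at [i] whenever one exists, so the class of [h] tests all elements at
     once. *)
  have [h hP] : {h : I -> A & forall i,
      fsat (fun m => if m == n then h i else g m i) p ->
      forall a, fsat (fun m => if m == n then a else g m i) p}.
    apply: (choice (P := fun i x => fsat (fun m => if m == n then x else g m i) p
      -> forall a, fsat (fun m => if m == n then a else g m i) p)) => i.
    have [pi|/existsNP[a pa]] :=
        EM (forall a, fsat (fun m => if m == n then a else g m i) p).
      by case: (carrier_inhabited A) => x; exists x.
    by exists a.
  have := pg (ultra_class h); rewrite updE => /IH; apply: filterS => i /= pi.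
  by apply: hP; rewrite updEi.
rewrite -(quot_reprK a) (updE (quot_repr a)); apply/IH.
by apply: filterS Up => i /= /(_ (quot_repr a i)); rewrite updEi.
Qed.

Lemma ultrapower_elementary : elementary_extension A ultrapower.
Proof.
exists (fun a => ultra_class (fun=> a)) => p v.
rewrite (Los p (fun n _ => v n)); split=> [pv|]; last by case/filter_ex.
by apply: filterE.
Qed.

End Ultrapower.

Arguments ultrapower {S} A {I} U {UU}.
Arguments ultra_cong {S} A {I} U {UU}.

(** * Idempotents in elementary extensions *)

(** The ultrapower is indexed by finite lists of operations. For each [f], the lists containing [f]
    form a set of the ultrafilter, and on it [x] picks elements fixed by [f]. *)
Lemma finitely_idempotent_extension (S : signature) (A : algebra S) :
  (forall L : seq {classic op S}, exists x : A,
    forall f, f \in L -> interp A f (fun=> x) = x) ->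
  exists B, elementary_extension A B /\ exists e : B, idempotent_element e.
Proof.
move=> /choice[x xP].
pose F : set_system (seq {classic op S}) :=
  [set W | exists L0 : seq {classic op S},
    forall L : seq {classic op S}, {subset L0 <= L} -> W L].
have FF : ProperFilter F.
  split=> [[L0 /(_ L0)]|]; first exact.
  split=> [|P Q [L0 L0P] [L1 L1Q]|P Q PQ [L0 L0P]].
  - by exists [::].
  - exists (L0 ++ L1) => L sL; split.
      by apply: L0P => f fL; apply: sL; rewrite mem_cat fL.
    by apply: L1Q => f fL; apply: sL; rewrite mem_cat fL orbT.
  - by exists L0 => L /L0P /PQ.
have [U [UU FU]] := ultraFilterLemma FF.
exists (ultrapower A U); split; first exact: ultrapower_elementary.
exists (ultra_class x) => f.
rewrite -(quot_pi_hom (ultra_cong A U) (f := f) (fun=> x)).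
apply/quot_piP/FU; exists [:: f] => L fL /=.
by apply: xP; apply: fL; rewrite mem_head.
Qed.

(* Identifying all variables lets a single quantifier bind them all. *)
Definition collapse (S : signature) (t : term S) : term S :=
  eval (A := term_alg S) (fun=> Var 0) t.

Fixpoint not_diagonally_solvable (S : signature) (p : seq (equation S)) :
    formula S :=
  if p is e :: p' then
    FImp (FEq (collapse (lhs e)) (collapse (rhs e))) (not_diagonally_solvable p')
  else FFalse S.

Lemma fsat_not_diagonally_solvable (S : signature) (A : algebra S)
    (v : nat -> A) p :
  fsat v (not_diagonally_solvable p) <-> ~ conj_sat (fun=> v 0) p.
Proof.
elim: p => [|e p IH] /=; first by split=> // /(_ I).
rewrite IH /collapse !eval_subst /=.
by split=> [h [/h]|h /[swap]]; [exact|move=> hp he; apply: h].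
Qed.

(** If [p] had no solution in [A], a single sentence would deny it constant solutions; this
    transfers to [B], where the constant valuation at [e] refutes it. *)
Lemma solvable_of_idempotent_extension (S : signature) (A B : algebra S) (e : B)
    (p : seq (equation S)) : elementary_extension A B -> idempotent_element e ->
  exists v : nat -> A, conj_sat v p.
Proof.
case=> i iP he; apply: contrapT => /forallNP np.
case: (carrier_inhabited A) => x.
have : fsat (fun=> x) (FAll 0 (not_diagonally_solvable p)).
  by move=> a; apply/fsat_not_diagonally_solvable.
move=> /iP /(_ e) /fsat_not_diagonally_solvable; apply.
by apply/conj_satP => d _; rewrite /eq_sat !eval_idempotent.
Qed.

(** * Structural completeness *)

Section Completeness.
Variables (S : signature) (Q : algebra S -> Prop).
Hypothesis hQ : is_quasivariety Q.

(** Two distinct variables coincide in a trivial free algebra, which is an identity valid throughout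
    [Q]. *)
Lemma trivial_of_trivial_free (A : algebra S) :
  trivial_algebra (free_alg Q) -> Q A -> trivial_algebra A.
Proof.
move=> trivF QA x y.
have /quot_piP := trivF (free_var Q 0) (free_var Q 1).
by move=> /(_ A QA (fun n => if n is 0 then x else y)).
Qed.

(** [R] is the quasivariety generated by the free algebra. Were it proper, minimality would make it
    trivial, hence also the free algebra and all of [Q]. *)
Lemma minimal_structurally_complete :
  minimal_quasivariety Q -> structurally_complete Q.
Proof.
move=> minQ q qF A QA.
pose R B := forall q, admissible Q q -> holds B q.
apply: contrapT => nqA.
have Rproper : proper_subquasivariety R Q.
  split.
  - by exists (admissible Q).
  - move=> B RB; apply/(quasivarietyP hQ) => r Qr; apply: RB.
    exact: (Qr _ (free_alg_mem hQ)).
  - by exists A => // /(_ q qF).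
have trivF : trivial_algebra (free_alg Q) by apply/(minQ R).1 => // r.
by apply: nqA => v _; apply: trivial_of_trivial_free trivF QA _ _.
Qed.

Lemma idempotent_structurally_complete (B : algebra S) (e : B) :
  almost_structurally_complete Q -> elementary_extension (free_alg Q) B ->
  idempotent_element e -> structurally_complete Q.
Proof.
move=> hASC extB he q qF; apply: hASC; split=> // -[_ np].
by have [v /np] := solvable_of_idempotent_extension (premises q) extB he.
Qed.

Definition idem_eqn (f : {classic op S}) : equation S :=
  Equation (App f (fun _ : 'I_(arity f) => Var 0)) (Var 0).

Lemma structurally_complete_minimal (L : seq {classic op S}) :
  semisimple Q -> structurally_complete Q ->
  (forall x : free_alg Q, ~ forall f, f \in L -> interp _ f (fun=> x) = x) ->
  minimal_quasivariety Q.
Proof.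
move=> hSS SC FL.
have QL (A : algebra S) (x : A) : Q A ->
    (forall f, f \in L -> interp A f (fun=> x) = x) -> trivial_algebra A.
  move=> QA xL y z.
  (* [Var 0] stands for the common idempotent, [Var 1] and [Var 2] for the points to be identified.
     By [FL] the premises are unsolvable in the free algebra, so [q] is vacuously admissible. *)
  pose q := QuasiIdentity [seq idem_eqn f | f <- L] (Equation (Var 1) (Var 2)).
  have qF : admissible Q q.
    move=> v /conj_satP vL; case: (FL (v 0)) => f fL.
    exact/(vL (idem_eqn f))/map_f.
  apply: (SC q qF A QA (fun n => nth x [:: x; y; z] n)).
  by apply/conj_satP => e /mapP[f fL ->]; apply: xL.
have key (R : algebra S -> Prop) (A : algebra S) : (forall B, R B -> Q B) ->
    is_quasivariety R -> R A -> ~ trivial_algebra A -> forall B, Q B -> R B.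
  move=> RQ hR RA ntA B QB; apply/(quasivarietyP hR) => -[phi psi] Rq.
  suff /(_ B QB) : holds_in Q (QuasiIdentity phi psi) by [].
  apply: contrapT => nQq.
  have npsi : ~ conseq Q [set` phi] psi.
    move=> [D [Dphi Dpsi]]; apply: nQq => C QC v /conj_satP /= vphi.
    by apply: (Dpsi C QC); apply/conj_satP => d /Dphi /vphi.
  have [a [aQ phia psia amax]] := maximal_omitting hQ npsi.
  have sA := hSS _ (maximal_omitting_subdirectly_irreducible hQ aQ psia amax).
  pose b := conseq_cong Q (diagram a `|` [set psi]).
  have ab : cong_le a b by move=> t s ats; apply: conseq_mem; left.
  (* Semisimplicity enters here: modulo [a], [b] relates the distinct classes of the two sides of
     [psi], hence everything. *)
  have b_total t s : b t s.
    have bpsi : diagram b psi by rewrite diagram_conseq; apply: conseq_mem; right.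
    have bQ : ConK Q (quot_cong ab) by apply/(ConK_quot_cong hQ)/(ConK_conseq hQ).
    apply/(quot_congE ab).
    apply: (simple_total hQ (A := quot_alg a) (x := quot_pi a (lhs psi))
      (y := quot_pi a (rhs psi)) sA bQ); first exact/quot_congE.
    by move=> /quot_piP.
  have [D [DX DL]] := @conseq_finite _ Q {classic op S} L
    (diagram a `|` [set psi]) idem_eqn (fun f _ => b_total _ _).
  (* Without [psi], the premises lie in the diagram of [a]; in [A], [psi] is recovered from [phi] by
     [Rq]. *)
  pose Delta := [seq d <- D | d != psi].
  have Delta_a d : d \in Delta ++ phi -> diagram a d.
    rewrite mem_cat mem_filter => /orP[/andP[/eqP dpsi /DX[]] //|/phia //].
  (* Otherwise the quasi-identity from [Delta ++ phi] to [psi] is vacuously admissible, hence valid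
     in the quotient by [a], where the classes of the variables refute it. *)
  have [u uDphi] : exists u : nat -> free_alg Q, conj_sat u (Delta ++ phi).
    apply: contrapT => /forallNP nDphi.
    apply: psia; apply/eq_sat_term_quot.
    apply: (SC (QuasiIdentity (Delta ++ phi) psi)) aQ _ _ => [v /nDphi //|].
    by apply/conj_satP => d /Delta_a ad; apply/eq_sat_term_quot.
  case: (carrier_inhabited A) => x.
  have [h [[hh _] _]] := free_alg_universal (fun=> x) (RQ A RA).
  have hu d : d \in Delta ++ phi -> eq_sat (fun n => h (u n)) d.
    by move=> dD; apply: eq_sat_hom => //; move/conj_satP: uDphi; apply.
  have hpsi : eq_sat (fun n => h (u n)) psi.
    apply: (Rq A RA); apply/conj_satP => d dphi.
    by apply: hu; rewrite mem_cat dphi orbT.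
  (* [idem_eqn] speaks of [Var 0], so the idempotent found in [A] is [h (u 0)]. *)
  apply: ntA; apply: (QL A (h (u 0)) (RQ A RA)) => f fL.
  apply: (DL A (RQ A RA) (fun n => h (u n)) _ f fL); apply/conj_satP => d dD.
  have [->//|dpsi] := eqVneq d psi.
  by apply: hu; rewrite mem_cat mem_filter dpsi dD.
move=> R; split=> [[hR RQ [B QB nRB]] A|Rtriv].
  split=> [RA|]; last exact: (trivial_mem hR).
  by apply: contrapT => ntA; apply/nRB/(key R A).
split.
- exists [set QuasiIdentity [::] (Equation (Var 0) (Var 1))] => A.
  rewrite Rtriv; split=> [trivA q _ v _|/(_ _ erefl) hA x y]; first exact: trivA.
  exact: (hA (fun n => if n is 0 then x else y) I).
- by move=> A /Rtriv; apply: (trivial_mem hQ).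
(* The element of a trivial free algebra would be a common idempotent, against [FL]. *)
- exists (free_alg Q); first exact: free_alg_mem.
  by move=> /Rtriv trivF; apply: (FL (free_var Q 0)) => f _; apply: trivF.
Qed.

End Completeness.

Theorem theorem4p2 (S : signature) (Q : algebra S -> Prop)
  (hQ : is_quasivariety Q)
  (hASC : almost_structurally_complete Q)
  (hSS : semisimple Q) :
  structurally_complete Q <->
    ((exists B : algebra S,
        elementary_extension (free_alg Q) B /\
        exists e : B, idempotent_element e)
     \/ minimal_quasivariety Q).
Proof.
split=> [SC|[[B [extB [e he]]]|]]; last exact: minimal_structurally_complete.
- have [/finitely_idempotent_extension|/existsNP[L /forallNP FL]] :=
    EM (forall L : seq {classic op S}, exists x : free_alg Q,
      forall f, f \in L -> interp _ f (fun=> x) = x); first by left.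
  by right; apply: (structurally_complete_minimal hQ (L := L)).
- exact: idempotent_structurally_complete hASC extB he.
Qed.
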